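(* Let $\mathsf{C}$ be a partializable and representable Markov category, with distribution functor $P$ and sampling maps $\mathrm{samp}_X\colon PX\to X$. Then the distribution objects $PX$ and the (images under $\mathsf{C}\hookrightarrow\mathsf{Partial}(\mathsf{C})$ of the) sampling maps of $\mathsf{C}$ define distribution objects and sampling maps in $\mathsf{Partial}(\mathsf{C})$. In particular, $\mathsf{Partial}(\mathsf{C})$ is representable. Under this correspondence, the copyable counterpart of a morphism of $\mathsf{Partial}(\mathsf{C})$ represented by $X\xleftarrow{i}D\xrightarrow{f}Y$ is the morphism represented by $X\xleftarrow{i}D\xrightarrow{f^\sharp}PY$. Furthermore, the pushforward $P\bigl(X\xleftarrow{i}D\xrightarrow{f}Y\bigr)$ (the value on this morphism of the distribution functor of $\mathsf{Partial}(\mathsf{C})$) is represented by $PX\xleftarrow{Pi}PD\xrightarrow{Pf}PY$.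
   Context: A CD category is a symmetric monoidal category $(\mathsf{C},\otimes,I)$ in which every object $X$ carries a commutative comonoid structure $\mathrm{copy}_X\colon X\to X\otimes X$, $\mathrm{del}_X\colon X\to I$, compatible with tensor products ($\mathrm{copy}_{X\otimes Y}$ is $\mathrm{copy}_X\otimes\mathrm{copy}_Y$ followed by swapping the two middle factors, and $\mathrm{del}_{X\otimes Y}=\mathrm{del}_X\otimes\mathrm{del}_Y$) and with $\mathrm{copy}_I=\mathrm{del}_I=\mathrm{id}_I$; coherence isomorphisms are suppressed. A morphism $f\colon X\to Y$ is total if $\mathrm{del}_Y\circ f=\mathrm{del}_X$, copyable if $\mathrm{copy}_Y\circ f=(f\otimes f)\circ\mathrm{copy}_X$, deterministic if it is both, and quasi-total if $(f\otimes(\mathrm{del}_Y\circ f))\circ\mathrm{copy}_X=f$. A Markov category is a CD category in which every morphism is total; a quasi-Markov category is a CD category in which every morphism is quasi-total. $\mathsf{C}_{\mathrm{cop}}$ denotes the wide subcategory of copyable morphisms (equal to the deterministic morphisms if $\mathsf{C}$ is Markov). A Markov category is positive if for all $u\colon X\to Y$, $v\colon Y\to Z$ with $v\circ u$ deterministic, $(u\otimes (v\circ u))\circ\mathrm{copy}_X=(\mathrm{id}_Y\otimes v)\circ\mathrm{copy}_Y\circ u$. Let $\mathsf{C}$ be quasi-Markov. A distribution object for $X$ is an object $PX$ with isomorphisms $\mathsf{C}(A,X)\cong\mathsf{C}_{\mathrm{cop}}(A,PX)$ natural in $A\in\mathsf{C}_{\mathrm{cop}}$. The sampling map $\mathrm{samp}_X\colon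 PX\to X$ is the counterpart of $\mathrm{id}_{PX}$; the copyable counterpart of $f\colon A\to X$ is denoted $f^\sharp\colon A\to PX$ and is the unique copyable morphism with $\mathrm{samp}_X\circ f^\sharp=f$. $\mathsf{C}$ is representable if every object has a distribution object; then the distribution objects assemble into the distribution functor $P\colon\mathsf{C}\to\mathsf{C}_{\mathrm{cop}}$, right adjoint to the inclusion $\mathsf{C}_{\mathrm{cop}}\hookrightarrow\mathsf{C}$, with $Pf=(f\circ\mathrm{samp}_X)^\sharp$ for $f\colon X\to Y$. A Markov category $\mathsf{C}$ is partializable if: (i) it is positive; (ii) pullbacks of deterministic monomorphisms along arbitrary morphisms exist and are themselves deterministic (monomorphisms); (iii) if $i\colon D\to X$ is a deterministic monomorphism then $i\otimes\mathrm{id}_A$ is a monomorphism for every object $A$. For $\mathsf{C}$ partializable, the CD category $\mathsf{Partial}(\mathsf{C})$ (which is quasi-Markov) has the objects of $\mathsf{C}$; its morphisms $X\to Y$ are equivalence classes of spans $X\xleftarrow{i}D\xrightarrow{f}Y$ (also written $(D,i,f)$) in $\mathsf{C}$ with $i$ a deterministic monomorphism, where $(D,i,f)\sim(D',i',f')$ iff there is an isomorphism $t\colon D\to D'$ with $i'\circ t=i$, $f'\circ t=f$. The composite of $(A,i,f)\colon X\to Y$ followed by $(B,j,g)\colon Y\to Z$ is $(C,i\circ u,g\circ v)$, where $A\xleftarrow{u}C\xrightarrow{v}B$ is the pullback of $f$ and $j$. The inclusion $\mathsf{C}\hookrightarrow\mathsf{Partial}(\mathsf{C})$ sends $f\colon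 X\to Y$ to $(X,\mathrm{id}_X,f)$. The tensor product is componentwise, $(A,i,f)\otimes(B,j,g)=(A\otimes B,i\otimes j,f\otimes g)$, and the copy and delete maps (and coherence isomorphisms) are the images of those of $\mathsf{C}$ under the inclusion. *)

(* Defs.v *)
From Corelib Require Import ssreflect ssrfun.
From Stdlib Require Import ClassicalEpsilon FunctionalExtensionality.
From Stdlib Require Import PropExtensionality ProofIrrelevance.

Set Implicit Arguments.
Unset Strict Implicit.
Unset Printing Implicit Defensive.

Declare Scope cat_scope.
Delimit Scope cat_scope with cat.
Local Open Scope cat_scope.

Reserved Notation "X ⟶ Y" (at level 90, right associativity).
Reserved Notation "g ∘ f" (at level 40, left associativity).
Reserved Notation "X ⊗ Y" (at level 38, left associativity).
Reserved Notation "f ⊗₁ g" (at level 38, left associativity).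

Record Category : Type := {
  Ob :> Type;
  Hom : Ob -> Ob -> Type;
  idm : forall X, Hom X X;
  comp : forall X Y Z, Hom Y Z -> Hom X Y -> Hom X Z;
  comp_idl : forall X Y (f : Hom X Y), comp (idm Y) f = f;
  comp_idr : forall X Y (f : Hom X Y), comp f (idm X) = f;
  comp_assoc : forall W X Y Z (h : Hom Y Z) (g : Hom X Y) (f : Hom W X),
    comp h (comp g f) = comp (comp h g) f
}.
Arguments Hom {_} X Y.
Arguments idm {_} X.
Arguments comp {_ X Y Z} g f.

Notation "X ⟶ Y" := (Hom X Y) : cat_scope.
Notation "g ∘ f" := (comp g f) : cat_scope.

Record Functor (C D : Category) : Type := {
  fob :> C -> D;
  fmap : forall X Y : C, (X ⟶ Y) -> (fob X ⟶ fob Y);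
  fmap_id : forall X : C, fmap (idm X) = idm (fob X);
  fmap_comp : forall (X Y Z : C) (g : Y ⟶ Z) (f : X ⟶ Y),
    fmap (g ∘ f) = fmap g ∘ fmap f
}.
Arguments fmap {C D} F {X Y} f : rename.

Section CategoryNotions.
Variable C : Category.

Definition is_iso (X Y : C) (f : X ⟶ Y) : Prop :=
  exists g : Y ⟶ X, g ∘ f = idm X /\ f ∘ g = idm Y.

Definition mono (X Y : C) (f : X ⟶ Y) : Prop :=
  forall (T : C) (a b : T ⟶ X), f ∘ a = f ∘ b -> a = b.

Definition is_pullback (X Y Z P : C)
    (f : X ⟶ Z) (g : Y ⟶ Z) (u : P ⟶ X) (v : P ⟶ Y) : Prop :=
  f ∘ u = g ∘ v /\
  forall (T : C) (a : T ⟶ X) (b : T ⟶ Y), f ∘ a = g ∘ b ->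
    exists! t : T ⟶ P, u ∘ t = a /\ v ∘ t = b.

End CategoryNotions.

(** Coherence isomorphisms are explicit: [assoc], [lunit], [runit]. *)
Record SymMonCategory : Type := {
  smc_cat :> Category;
  tens : smc_cat -> smc_cat -> smc_cat;
  tensm : forall X X' Y Y' : smc_cat,
    (X ⟶ X') -> (Y ⟶ Y') -> (tens X Y ⟶ tens X' Y');
  unit : smc_cat;
  assoc : forall X Y Z : smc_cat, tens (tens X Y) Z ⟶ tens X (tens Y Z);
  assoc_inv : forall X Y Z : smc_cat, tens X (tens Y Z) ⟶ tens (tens X Y) Z;
  lunit : forall X : smc_cat, tens unit X ⟶ X;
  lunit_inv : forall X : smc_cat, X ⟶ tens unit X;
  runit : forall X : smc_cat, tens X unit ⟶ X;
  runit_inv : forall X : smc_cat, X ⟶ tens X unit;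
  swap : forall X Y : smc_cat, tens X Y ⟶ tens Y X;
  tensm_id : forall X Y : smc_cat, tensm (idm X) (idm Y) = idm (tens X Y);
  tensm_comp : forall (X X' X'' Y Y' Y'' : smc_cat)
      (f' : X' ⟶ X'') (f : X ⟶ X') (g' : Y' ⟶ Y'') (g : Y ⟶ Y'),
    tensm (f' ∘ f) (g' ∘ g) = tensm f' g' ∘ tensm f g;
  assocK : forall X Y Z : smc_cat, assoc_inv X Y Z ∘ assoc X Y Z = idm _;
  assoc_invK : forall X Y Z : smc_cat, assoc X Y Z ∘ assoc_inv X Y Z = idm _;
  lunitK : forall X : smc_cat, lunit_inv X ∘ lunit X = idm _;
  lunit_invK : forall X : smc_cat, lunit X ∘ lunit_inv X = idm _;
  runitK : forall X : smc_cat, runit_inv X ∘ runit X = idm _;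
  runit_invK : forall X : smc_cat, runit X ∘ runit_inv X = idm _;
  swapK : forall X Y : smc_cat, swap Y X ∘ swap X Y = idm _;
  assoc_nat : forall (X X' Y Y' Z Z' : smc_cat)
      (f : X ⟶ X') (g : Y ⟶ Y') (h : Z ⟶ Z'),
    assoc X' Y' Z' ∘ tensm (tensm f g) h = tensm f (tensm g h) ∘ assoc X Y Z;
  lunit_nat : forall (X X' : smc_cat) (f : X ⟶ X'),
    lunit X' ∘ tensm (idm unit) f = f ∘ lunit X;
  runit_nat : forall (X X' : smc_cat) (f : X ⟶ X'),
    runit X' ∘ tensm f (idm unit) = f ∘ runit X;
  swap_nat : forall (X X' Y Y' : smc_cat) (f : X ⟶ X') (g : Y ⟶ Y'),
    swap X' Y' ∘ tensm f g = tensm g f ∘ swap X Y;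
  triangle : forall X Y : smc_cat,
    tensm (idm X) (lunit Y) ∘ assoc X unit Y = tensm (runit X) (idm Y);
  pentagon : forall W X Y Z : smc_cat,
    assoc W X (tens Y Z) ∘ assoc (tens W X) Y Z
    = tensm (idm W) (assoc X Y Z) ∘ assoc W (tens X Y) Z
      ∘ tensm (assoc W X Y) (idm Z);
  hexagon : forall X Y Z : smc_cat,
    assoc Y Z X ∘ swap X (tens Y Z) ∘ assoc X Y Z
    = tensm (idm Y) (swap X Z) ∘ assoc Y X Z ∘ tensm (swap X Y) (idm Z)
}.
Arguments tens {_} X Y.
Arguments tensm {_ X X' Y Y'} f g.
Arguments unit {_}.
Arguments assoc {_} X Y Z.
Arguments assoc_inv {_} X Y Z.
Arguments lunit {_} X.
Arguments lunit_inv {_} X.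
Arguments runit {_} X.
Arguments runit_inv {_} X.
Arguments swap {_} X Y.

Notation "X ⊗ Y" := (tens X Y) : cat_scope.
Notation "f ⊗₁ g" := (tensm f g) : cat_scope.

Definition mid_swap (C : SymMonCategory) (A B X Y : C) :
    (A ⊗ B) ⊗ (X ⊗ Y) ⟶ (A ⊗ X) ⊗ (B ⊗ Y) :=
  assoc_inv A X (B ⊗ Y)
  ∘ (idm A ⊗₁ (assoc X B Y ∘ (swap B X ⊗₁ idm Y) ∘ assoc_inv B X Y))
  ∘ assoc A B (X ⊗ Y).

Record CDCategory : Type := {
  cd_smc :> SymMonCategory;
  copy : forall X : cd_smc, X ⟶ X ⊗ X;
  del : forall X : cd_smc, X ⟶ unit;
  copy_assoc : forall X : cd_smc,
    assoc X X X ∘ (copy X ⊗₁ idm X) ∘ copy X = (idm X ⊗₁ copy X) ∘ copy X;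
  copy_dell : forall X : cd_smc, lunit X ∘ (del X ⊗₁ idm X) ∘ copy X = idm X;
  copy_delr : forall X : cd_smc, runit X ∘ (idm X ⊗₁ del X) ∘ copy X = idm X;
  copy_swap : forall X : cd_smc, swap X X ∘ copy X = copy X;
  copy_tens : forall X Y : cd_smc,
    copy (X ⊗ Y) = mid_swap X X Y Y ∘ (copy X ⊗₁ copy Y);
  del_tens : forall X Y : cd_smc,
    del (X ⊗ Y) = lunit unit ∘ (del X ⊗₁ del Y);
  copy_unit : copy unit = lunit_inv unit;
  del_unit : del unit = idm unit
}.
Arguments copy {_} X.
Arguments del {_} X.

Section CDNotions.
Variable C : CDCategory.

Definition total (X Y : C) (f : X ⟶ Y) : Prop := del Y ∘ f = del X.

Definition copyable (X Y : C) (f : X ⟶ Y) : Prop :=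
  copy Y ∘ f = (f ⊗₁ f) ∘ copy X.

Definition deterministic (X Y : C) (f : X ⟶ Y) : Prop :=
  total f /\ copyable f.

Definition quasi_total (X Y : C) (f : X ⟶ Y) : Prop :=
  runit Y ∘ (f ⊗₁ (del Y ∘ f)) ∘ copy X = f.

Definition det_mono (X Y : C) (f : X ⟶ Y) : Prop :=
  deterministic f /\ mono f.

Definition markov : Prop := forall (X Y : C) (f : X ⟶ Y), total f.

Definition quasi_markov : Prop := forall (X Y : C) (f : X ⟶ Y), quasi_total f.

Definition positive : Prop :=
  forall (X Y Z : C) (u : X ⟶ Y) (v : Y ⟶ Z), deterministic (v ∘ u) ->
    (u ⊗₁ (v ∘ u)) ∘ copy X = (idm Y ⊗₁ v) ∘ copy Y ∘ u.

End CDNotions.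

Record partializable (C : CDCategory) : Prop := {
  part_markov : markov C;
  part_positive : positive C;
  part_pullback : forall (X Y Z : C) (f : X ⟶ Z) (j : Y ⟶ Z), det_mono j ->
    exists (P : C) (u : P ⟶ X) (v : P ⟶ Y), is_pullback f j u v;
  part_pullback_det_mono : forall (X Y Z P : C) (f : X ⟶ Z) (j : Y ⟶ Z)
      (u : P ⟶ X) (v : P ⟶ Y),
    det_mono j -> is_pullback f j u v -> det_mono u;
  part_tens_mono : forall (D X A : C) (i : D ⟶ X),
    det_mono i -> mono (i ⊗₁ idm A)
}.

Section Copyable.
Variable C : CDCategory.

Lemma copyable_id (X : C) : copyable (idm X).
Proof. by rewrite /copyable tensm_id comp_idl comp_idr. Qed.

Lemma copyable_comp (X Y Z : C) (g : Y ⟶ Z) (f : X ⟶ Y) :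
  copyable g -> copyable f -> copyable (g ∘ f).
Proof.
move=> hg hf; rewrite /copyable comp_assoc hg -comp_assoc hf comp_assoc.
by rewrite tensm_comp.
Qed.

Record cop_hom (X Y : C) : Type := CopHom {
  cop_val :> X ⟶ Y;
  cop_prop : copyable cop_val
}.

Lemma cop_hom_eq (X Y : C) (f g : cop_hom X Y) :
  cop_val f = cop_val g -> f = g.
Proof.
case: f g => f hf [g hg] /= e; subst g; congr CopHom; exact: proof_irrelevance.
Qed.

Definition Cop : Category.
Proof.
refine {| Ob := Ob C; Hom := cop_hom;
  idm := fun X => CopHom (copyable_id X);
  comp := fun X Y Z g f => CopHom (copyable_comp (cop_prop g) (cop_prop f)) |}.
- abstract (by move=> X Y f; apply: cop_hom_eq; exact: comp_idl).
- abstract (by move=> X Y f; apply: cop_hom_eq; exact: comp_idr).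
- abstract (by move=> W X Y Z h g f; apply: cop_hom_eq; exact: comp_assoc).
Defined.

(** Naturality is only in [A], along copyable morphisms; [PX] is not assumed
    functorial in [X]. *)
Record distribution_iso (X PX : C) : Type := {
  sharp : forall A : C, (A ⟶ X) -> cop_hom A PX;
  flat : forall A : C, cop_hom A PX -> (A ⟶ X);
  sharpK : forall (A : C) (f : A ⟶ X), flat (sharp f) = f;
  flatK : forall (A : C) (g : cop_hom A PX), sharp (flat g) = g;
  sharp_nat : forall (A B : C) (h : cop_hom A B) (f : B ⟶ X),
    sharp (f ∘ h) = @comp Cop A B PX (sharp f) h
}.

Definition samp (X PX : C) (d : distribution_iso X PX) : PX ⟶ X :=
  flat d (idm (PX : Cop)).

Definition representable : Prop :=
  forall X : C, exists PX : C, inhabited (distribution_iso X PX).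

Record distributions : Type := Distributions {
  dist :> C -> C;
  dist_iso : forall X : C, distribution_iso X (dist X)
}.

Lemma samp_sharp (X PX : C) (d : distribution_iso X PX) (A : C) (f : A ⟶ X) :
  samp d ∘ sharp d f = f.
Proof.
rewrite -[LHS](sharpK d) sharp_nat /samp flatK.
by rewrite (comp_idl (sharp d f : (A : Cop) ⟶ PX)) sharpK.
Qed.

Lemma sharp_unique (X PX : C) (d : distribution_iso X PX) (A : C) (f : A ⟶ X)
    (g : cop_hom A PX) : samp d ∘ g = f -> g = sharp d f.
Proof.
move=> <-; rewrite sharp_nat /samp flatK.
by rewrite (comp_idl (g : (A : Cop) ⟶ PX)).
Qed.

Section DistributionFunctor.
Variable P : distributions.

Definition dist_map (X Y : C) (f : X ⟶ Y) : cop_hom (P X) (P Y) :=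
  sharp (dist_iso P Y) (f ∘ samp (dist_iso P X)).

Definition distribution_functor : Functor C Cop.
Proof.
refine {| fob := (dist P : C -> Cop); fmap := dist_map |}.
- abstract (move=> X; symmetry; apply: sharp_unique => /=;
            by rewrite comp_idl comp_idr).
- abstract (move=> X Y Z g f; symmetry; apply: sharp_unique => /=;
            by rewrite comp_assoc samp_sharp -comp_assoc samp_sharp comp_assoc).
Defined.

End DistributionFunctor.

End Copyable.

Section CategoryFacts.
Variable C : Category.

Lemma mono_comp (X Y Z : C) (g : Y ⟶ Z) (f : X ⟶ Y) :
  mono g -> mono f -> mono (g ∘ f).
Proof. by move=> hg hf T a b; rewrite -!comp_assoc => /hg /hf. Qed.

Lemma mono_id (X : C) : mono (idm X).
Proof. by move=> T a b; rewrite !comp_idl. Qed.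

Lemma mono_pullback (X Y Z P : C) (f : X ⟶ Z) (j : Y ⟶ Z)
    (u : P ⟶ X) (v : P ⟶ Y) :
  mono j -> mono u -> f ∘ u = j ∘ v ->
  (forall (T : C) (a : T ⟶ X) (b : T ⟶ Y), f ∘ a = j ∘ b ->
     exists t : T ⟶ P, u ∘ t = a) ->
  is_pullback f j u v.
Proof.
move=> hj hu e h; split=> // T a b eab; have [t et] := h T a b eab.
exists t; split; last by move=> t' [et' _]; apply: hu; rewrite et et'.
by split=> //; apply: hj; rewrite comp_assoc -e -comp_assoc et.
Qed.

Lemma pullback_mono (X Y Z P : C) (f : X ⟶ Z) (j : Y ⟶ Z)
    (u : P ⟶ X) (v : P ⟶ Y) : mono j -> is_pullback f j u v -> mono u.
Proof.
move=> hj [e h] T a b eab.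
have e1 : f ∘ (u ∘ a) = j ∘ (v ∘ a) by rewrite !comp_assoc e.
have [t [_ ut]] := h _ _ _ e1.
have <- : t = a by apply: ut.
apply: ut; rewrite eab; split=> //.
by apply: hj; rewrite !comp_assoc -e -!comp_assoc eab.
Qed.

Lemma pullback_iso (X Y Z P : C) (f : X ⟶ Z) (f' : Z ⟶ X) (j : Y ⟶ Z)
    (u : P ⟶ X) (v : P ⟶ Y) (v' : Y ⟶ P) :
  f' ∘ f = idm X -> v ∘ v' = idm Y -> v' ∘ v = idm P ->
  f ∘ u = j ∘ v -> is_pullback f j u v.
Proof.
move=> hf hv hv' e; split=> // T a b eab.
exists (v' ∘ b); split.
  split; last by rewrite comp_assoc hv comp_idl.
  rewrite -[u]comp_idl -hf -(comp_assoc f') e -!comp_assoc (comp_assoc v) hv.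
  by rewrite comp_idl -eab comp_assoc hf comp_idl.
by move=> t [_ <-]; rewrite comp_assoc hv' comp_idl.
Qed.

End CategoryFacts.

Section MonoidalFacts.
Variable C : SymMonCategory.

Lemma assoc_inv_nat (X X' Y Y' Z Z' : C)
    (f : X ⟶ X') (g : Y ⟶ Y') (h : Z ⟶ Z') :
  assoc_inv X' Y' Z' ∘ (f ⊗₁ (g ⊗₁ h)) = ((f ⊗₁ g) ⊗₁ h) ∘ assoc_inv X Y Z.
Proof.
rewrite -[RHS]comp_idl -(assocK X' Y' Z') -!comp_assoc; congr (_ ∘ _).
by rewrite comp_assoc assoc_nat -comp_assoc assoc_invK comp_idr.
Qed.

Lemma mid_swap_nat (A A' B B' X X' Y Y' : C)
    (a : A ⟶ A') (b : B ⟶ B') (x : X ⟶ X') (y : Y ⟶ Y') :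
  mid_swap A' B' X' Y' ∘ ((a ⊗₁ b) ⊗₁ (x ⊗₁ y))
  = ((a ⊗₁ x) ⊗₁ (b ⊗₁ y)) ∘ mid_swap A B X Y.
Proof.
rewrite /mid_swap -!comp_assoc assoc_nat !comp_assoc -assoc_inv_nat.
rewrite -!(comp_assoc (assoc_inv _ _ _)); congr (_ ∘ _); congr (_ ∘ _).
rewrite -!tensm_comp comp_idl comp_idr; congr (_ ⊗₁ _).
rewrite -!comp_assoc assoc_inv_nat !comp_assoc -assoc_nat.
rewrite -!(comp_assoc (assoc _ _ _)); congr (_ ∘ _).
rewrite -!tensm_comp swap_nat.
by rewrite comp_idl comp_idr.
Qed.

Lemma tens_mono (X X' Y Y' : C) (f : X ⟶ X') (g : Y ⟶ Y') :
  mono (f ⊗₁ idm Y') -> mono (g ⊗₁ idm X) -> mono (f ⊗₁ g).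
Proof.
move=> hf hg; have -> : f ⊗₁ g = (f ⊗₁ idm Y') ∘ (idm X ⊗₁ g).
  by rewrite -tensm_comp comp_idl comp_idr.
apply: mono_comp => // T a b e; have e' : swap X Y ∘ a = swap X Y ∘ b.
  by apply: hg; rewrite !comp_assoc -!swap_nat -!comp_assoc e.
by rewrite -[a]comp_idl -[b]comp_idl -(swapK X Y) -!comp_assoc e'.
Qed.

End MonoidalFacts.

Section MarkovFacts.
Variable C : CDCategory.

Lemma det_copyable (X Y : C) (f : X ⟶ Y) : deterministic f -> copyable f.
Proof. by case. Qed.

Lemma deterministic_id (X : C) : deterministic (idm X).
Proof. by split; [rewrite /total comp_idr | exact: copyable_id]. Qed.

Lemma deterministic_comp (X Y Z : C) (g : Y ⟶ Z) (f : X ⟶ Y) :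
  deterministic g -> deterministic f -> deterministic (g ∘ f).
Proof.
move=> [tg cg] [tf cf]; split; last exact: copyable_comp.
by rewrite /total comp_assoc tg.
Qed.

Lemma det_mono_id (X : C) : det_mono (idm X).
Proof. by split; [exact: deterministic_id | exact: mono_id]. Qed.

Lemma det_mono_comp (X Y Z : C) (g : Y ⟶ Z) (f : X ⟶ Y) :
  det_mono g -> det_mono f -> det_mono (g ∘ f).
Proof.
by move=> [? ?] [? ?]; split; [exact: deterministic_comp | exact: mono_comp].
Qed.

Hypothesis hM : markov C.

Lemma to_unit (X : C) (f : X ⟶ unit) : f = del X.
Proof. by rewrite -(hM f) del_unit comp_idl. Qed.

Lemma copyable_tens (X X' Y Y' : C) (f : X ⟶ X') (g : Y ⟶ Y') :
  copyable f -> copyable g -> copyable (f ⊗₁ g).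
Proof.
move=> hf hg; rewrite /copyable !copy_tens -comp_assoc -tensm_comp hf hg.
by rewrite tensm_comp comp_assoc mid_swap_nat -comp_assoc.
Qed.

Definition proj1m (X Y : C) : X ⊗ Y ⟶ X := runit X ∘ (idm X ⊗₁ del Y).
Definition proj2m (X Y : C) : X ⊗ Y ⟶ Y := lunit Y ∘ (del X ⊗₁ idm Y).

Lemma proj1m_nat (X X' Y Y' : C) (f : X ⟶ X') (g : Y ⟶ Y') :
  proj1m X' Y' ∘ (f ⊗₁ g) = f ∘ proj1m X Y.
Proof.
rewrite /proj1m comp_assoc -runit_nat -!comp_assoc -!tensm_comp (hM g).
by rewrite !comp_idl comp_idr.
Qed.

Lemma proj2m_nat (X X' Y Y' : C) (f : X ⟶ X') (g : Y ⟶ Y') :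
  proj2m X' Y' ∘ (f ⊗₁ g) = g ∘ proj2m X Y.
Proof.
rewrite /proj2m comp_assoc -lunit_nat -!comp_assoc -!tensm_comp (hM f).
by rewrite !comp_idl comp_idr.
Qed.

Lemma proj1m_copy (X : C) : proj1m X X ∘ copy X = idm X.
Proof. exact: copy_delr. Qed.

Lemma proj2m_copy (X : C) : proj2m X X ∘ copy X = idm X.
Proof. exact: copy_dell. Qed.

Lemma markov_quasi_markov : quasi_markov C.
Proof.
move=> X Y f; rewrite /quasi_total (hM f) -[f in f ⊗₁ _]comp_idr.
rewrite -[del X]comp_idl tensm_comp !comp_assoc runit_nat -!comp_assoc.
by rewrite (comp_assoc (runit X)) copy_delr comp_idr.
Qed.

Lemma swap_unit : swap (unit : C) unit = idm _.
Proof.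
rewrite -[LHS]comp_idl -[RHS]comp_idl -(lunitK unit) -!comp_assoc.
by congr (_ ∘ _); rewrite [LHS]to_unit [RHS]to_unit.
Qed.

Lemma projs_copy (X Y : C) :
  (proj1m X Y ⊗₁ proj2m X Y) ∘ copy (X ⊗ Y) = idm (X ⊗ Y).
Proof.
rewrite copy_tens /proj1m /proj2m tensm_comp -comp_assoc.
rewrite (comp_assoc ((idm X ⊗₁ del Y) ⊗₁ _)) -mid_swap_nat.
have -> : mid_swap X unit unit Y = idm _.
  rewrite /mid_swap swap_unit tensm_id comp_idr assoc_invK tensm_id comp_idr.
  exact: assocK.
rewrite comp_idl -!tensm_comp !comp_assoc copy_delr copy_dell.
exact: tensm_id.
Qed.

Lemma det_projs (T X Y : C) (e : T ⟶ X ⊗ Y) : copyable e ->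
  e = ((proj1m X Y ∘ e) ⊗₁ (proj2m X Y ∘ e)) ∘ copy T.
Proof.
move=> he; rewrite tensm_comp -comp_assoc -he comp_assoc projs_copy.
by rewrite comp_idl.
Qed.

End MarkovFacts.

Section Partial.
Variable C : CDCategory.
Hypothesis hC : partializable C.

Let hM : markov C := part_markov hC.

Lemma det_mono_tens (X X' Y Y' : C) (f : X ⟶ X') (g : Y ⟶ Y') :
  det_mono f -> det_mono g -> det_mono (f ⊗₁ g).
Proof.
move=> hf hg; split; last by apply: tens_mono; exact: part_tens_mono.
split; first exact: hM.
by case: hf hg => [[_ ?] _] [[_ ?] _]; exact: copyable_tens.
Qed.

Lemma factor_l (D X Y T : C) (i : D ⟶ X) (a : T ⟶ X ⊗ Y) (c : T ⟶ D) :
  det_mono i -> proj1m X Y ∘ a = i ∘ c ->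
  exists a' : T ⟶ D ⊗ Y, a = (i ⊗₁ idm Y) ∘ a'.
Proof.
move=> hi ea.
have [E [e [q pb]]] := part_pullback hC (proj1m X Y) hi.
have [[_ de] _] := part_pullback_det_mono hC hi pb.
case: pb => comm univ; have [t [[<- _] _]] := univ _ _ _ ea.
exists (((q ⊗₁ (proj2m X Y ∘ e)) ∘ copy E) ∘ t).
rewrite {1}(det_projs hM de) comm !comp_assoc -tensm_comp.
by rewrite comp_idl.
Qed.

Lemma factor_r (D X Y T : C) (i : D ⟶ Y) (a : T ⟶ X ⊗ Y) (c : T ⟶ D) :
  det_mono i -> proj2m X Y ∘ a = i ∘ c ->
  exists a' : T ⟶ X ⊗ D, a = (idm X ⊗₁ i) ∘ a'.
Proof.
move=> hi ea.
have [E [e [q pb]]] := part_pullback hC (proj2m X Y) hi.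
have [[_ de] _] := part_pullback_det_mono hC hi pb.
case: pb => comm univ; have [t [[<- _] _]] := univ _ _ _ ea.
exists ((((proj1m X Y ∘ e) ⊗₁ q) ∘ copy E) ∘ t).
rewrite {1}(det_projs hM de) comm !comp_assoc -tensm_comp.
by rewrite comp_idl.
Qed.

Lemma factor_tens (D D' X X' T : C) (i : D ⟶ X) (i' : D' ⟶ X')
    (a : T ⟶ X ⊗ X') (c : T ⟶ D) (c' : T ⟶ D') :
  det_mono i -> det_mono i' ->
  proj1m X X' ∘ a = i ∘ c -> proj2m X X' ∘ a = i' ∘ c' ->
  exists t : T ⟶ D ⊗ D', (i ⊗₁ i') ∘ t = a.
Proof.
move=> hi hi' e1 e2; have [a' ea'] := factor_l hi e1; subst a.
move: e2; rewrite comp_assoc (proj2m_nat hM) comp_idl => e2.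
have [a'' ea''] := factor_r hi' e2; subst a'; exists a''.
by rewrite comp_assoc -tensm_comp comp_idl comp_idr.
Qed.

Lemma pullback_tens (X Y Z P X' Y' Z' P' : C)
    (f : X ⟶ Z) (j : Y ⟶ Z) (u : P ⟶ X) (v : P ⟶ Y)
    (f' : X' ⟶ Z') (j' : Y' ⟶ Z') (u' : P' ⟶ X') (v' : P' ⟶ Y') :
  det_mono j -> det_mono j' ->
  is_pullback f j u v -> is_pullback f' j' u' v' ->
  is_pullback (f ⊗₁ f') (j ⊗₁ j') (u ⊗₁ u') (v ⊗₁ v').
Proof.
move=> hj hj' pb pb'.
have hu := part_pullback_det_mono hC hj pb.
have hu' := part_pullback_det_mono hC hj' pb'.
case: pb pb' => [e univ] [e' univ']; apply: mono_pullback.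
- by have [] := det_mono_tens hj hj'.
- by have [] := det_mono_tens hu hu'.
- by rewrite -!tensm_comp e e'.
- move=> T a b eab.
have e1 : f ∘ (proj1m X X' ∘ a) = j ∘ (proj1m Y Y' ∘ b).
  by rewrite (comp_assoc f) (comp_assoc j) -(proj1m_nat hM f f')
             -(proj1m_nat hM j j') -!(comp_assoc (proj1m Z Z')) eab.
have e2 : f' ∘ (proj2m X X' ∘ a) = j' ∘ (proj2m Y Y' ∘ b).
  by rewrite (comp_assoc f') (comp_assoc j') -(proj2m_nat hM f f')
             -(proj2m_nat hM j j') -!(comp_assoc (proj2m Z Z')) eab.
have [c [[ec _] _]] := univ _ _ _ e1; have [c' [[ec' _] _]] := univ' _ _ _ e2.
by apply: factor_tens hu hu' (esym ec) (esym ec').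
Qed.

Record span (X Y : C) : Type := Span {
  span_dom : C;
  span_leg : span_dom ⟶ X;
  span_map : span_dom ⟶ Y;
  span_leg_det_mono : det_mono span_leg
}.

Definition span_equiv (X Y : C) (s s' : span X Y) : Prop :=
  exists t : span_dom s ⟶ span_dom s',
    is_iso t /\ span_leg s' ∘ t = span_leg s /\ span_map s' ∘ t = span_map s.

Lemma span_equiv_refl (X Y : C) (s : span X Y) : span_equiv s s.
Proof.
by exists (idm _); rewrite !comp_idr; split=> //; exists (idm _);
   rewrite comp_idl.
Qed.

Lemma span_equiv_sym (X Y : C) (s s' : span X Y) :
  span_equiv s s' -> span_equiv s' s.
Proof.
move=> [t [[t' [k k']] [el em]]]; exists t'; split; first by exists t.
by rewrite -el -em -!comp_assoc k' !comp_idr.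
Qed.

Lemma span_equiv_trans (X Y : C) (s1 s2 s3 : span X Y) :
  span_equiv s1 s2 -> span_equiv s2 s3 -> span_equiv s1 s3.
Proof.
move=> [t [[t' [k k']] [el em]]] [r [[r' [l l']] [fl fm]]].
exists (r ∘ t); rewrite !comp_assoc fl fm el em; split=> //.
exists (t' ∘ r'); split.
  by rewrite comp_assoc -(comp_assoc t') l comp_idr.
by rewrite comp_assoc -(comp_assoc r) k' comp_idr.
Qed.

(** An equivalence class is the set of spans it contains; by function and
    propositional extensionality, equality of classes is Leibniz equality. *)
Record partial_hom (X Y : C) : Type := PartialHom {
  partial_mem :> span X Y -> Prop;
  partial_mem_class : exists s, partial_mem = span_equiv s
}.

Definition span_class (X Y : C) (s : span X Y) : partial_hom X Y :=
  @PartialHom X Y (span_equiv s) (ex_intro _ s eq_refl).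

Lemma span_classP (X Y : C) (F : partial_hom X Y) : exists s, F = span_class s.
Proof.
case: F => F hF; case: (hF) => s e; exists s; subst F.
by rewrite /span_class; congr PartialHom; exact: proof_irrelevance.
Qed.

Lemma span_class_eq (X Y : C) (s s' : span X Y) :
  span_class s = span_class s' <-> span_equiv s s'.
Proof.
split=> [e|h].
  have : partial_mem (span_class s') s' by exact: span_equiv_refl.
  by rewrite -e.
have e : span_equiv s = span_equiv s'.
  apply: functional_extensionality => r; apply: propositional_extensionality.
  by split; apply: span_equiv_trans => //; exact: span_equiv_sym.
rewrite /span_class; move: (ex_intro _ s _) (ex_intro _ s' _); rewrite e.
by move=> p p'; congr PartialHom; exact: proof_irrelevance.
Qed.

Definition span_repr (X Y : C) (F : partial_hom X Y) : span X Y :=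
  proj1_sig (constructive_indefinite_description _ (span_classP F)).

Lemma span_reprK (X Y : C) (F : partial_hom X Y) :
  span_class (span_repr F) = F.
Proof.
by rewrite /span_repr; case: constructive_indefinite_description.
Qed.

Lemma span_repr_equiv (X Y : C) (s : span X Y) :
  span_equiv s (span_repr (span_class s)).
Proof. by apply/span_class_eq; rewrite span_reprK. Qed.

Definition chosen_pullback (X Y Z : C) (f : X ⟶ Z) (j : Y ⟶ Z)
    (hj : det_mono j) :
  {P : C & {u : P ⟶ X & {v : P ⟶ Y | is_pullback f j u v}}} :=
  let (P, h1) :=
    constructive_indefinite_description _ (part_pullback hC f hj) in
  let (u, h2) := constructive_indefinite_description _ h1 in
  let (v, h3) := constructive_indefinite_description _ h2 in
  existT _ P (existT _ u (exist _ v h3)).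

Definition span_comp_at (X Y Z : C) (t : span Y Z) (s : span X Y) (P : C)
    (u : P ⟶ span_dom s) (v : P ⟶ span_dom t)
    (pb : is_pullback (span_map s) (span_leg t) u v) : span X Z :=
  Span (span_map t ∘ v)
    (det_mono_comp (span_leg_det_mono s)
       (part_pullback_det_mono hC (span_leg_det_mono t) pb)).

Definition span_comp (X Y Z : C) (t : span Y Z) (s : span X Y) : span X Z :=
  let (P, h1) := chosen_pullback (span_map s) (span_leg_det_mono t) in
  let (u, h2) := h1 in
  let (v, pb) := h2 in
  span_comp_at pb.

(** Computed from chosen representatives and a chosen pullback;
    [partial_compE] shows that any other choice gives the same class. *)
Definition partial_comp (X Y Z : C) (G : partial_hom Y Z) (F : partial_hom X Y) :
    partial_hom X Z :=
  span_class (span_comp (span_repr G) (span_repr F)).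

Lemma span_comp_equiv (X Y Z : C) (t t' : span Y Z) (s s' : span X Y) (P : C)
    (u : P ⟶ span_dom s) (v : P ⟶ span_dom t)
    (pb : is_pullback (span_map s) (span_leg t) u v) :
  span_equiv s s' -> span_equiv t t' ->
  span_equiv (span_comp_at pb) (span_comp t' s').
Proof.
move=> [a [[a' [ka ka']] [al am]]] [b [[b' [kb kb']] [bl bm]]].
rewrite /span_comp.
case: chosen_pullback => P' [u' [v' pb']].
case: (pb) (pb') => [e univ] [e' univ'].
have e1 : span_map s' ∘ (a ∘ u) = span_leg t' ∘ (b ∘ v).
  by rewrite !comp_assoc am bl.
have e2 : span_map s ∘ (a' ∘ u') = span_leg t ∘ (b' ∘ v').
  rewrite -am -bl !comp_assoc -(comp_assoc _ a) ka' comp_idr.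
  by rewrite -(comp_assoc _ b) kb' comp_idr.
have [r [[ru rv] _]] := univ' _ _ _ e1.
have [r' [[ru' rv'] _]] := univ _ _ _ e2.
exists r => /=; split; last first.
  split; first by rewrite -comp_assoc ru comp_assoc al.
  by rewrite -comp_assoc rv comp_assoc bm.
exists r'; split.
  apply: (pullback_mono (proj2 (span_leg_det_mono t)) pb).
  by rewrite comp_assoc ru' -comp_assoc ru comp_assoc ka comp_idl comp_idr.
apply: (pullback_mono (proj2 (span_leg_det_mono t')) pb').
by rewrite comp_assoc ru -comp_assoc ru' comp_assoc ka' comp_idl comp_idr.
Qed.

Lemma partial_comp_class (X Y Z : C) (t : span Y Z) (s : span X Y) (P : C)
    (u : P ⟶ span_dom s) (v : P ⟶ span_dom t)
    (pb : is_pullback (span_map s) (span_leg t) u v) :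
  partial_comp (span_class t) (span_class s) = span_class (span_comp_at pb).
Proof.
symmetry; apply/span_class_eq; apply: span_comp_equiv; exact: span_repr_equiv.
Qed.

Lemma span_class_ext (X Y D : C) (i i' : D ⟶ X) (f f' : D ⟶ Y)
    (hi : det_mono i) (hi' : det_mono i') :
  i = i' -> f = f' -> span_class (Span f hi) = span_class (Span f' hi').
Proof.
move=> e e'; subst i' f'; congr span_class; congr Span.
exact: proof_irrelevance.
Qed.

Lemma partial_compE (X Y Z A B P : C)
    (i : A ⟶ X) (f : A ⟶ Y) (hi : det_mono i)
    (j : B ⟶ Y) (g : B ⟶ Z) (hj : det_mono j)
    (u : P ⟶ A) (v : P ⟶ B) (k : P ⟶ X) (h : P ⟶ Z) (hk : det_mono k) :
  is_pullback f j u v -> k = i ∘ u -> h = g ∘ v ->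
  partial_comp (span_class (Span g hj)) (span_class (Span f hi))
  = span_class (Span h hk).
Proof.
move=> pb ek eh.
rewrite (@partial_comp_class _ _ _ (Span g hj) (Span f hi) P u v pb).
exact: span_class_ext.
Qed.

Definition incl (X Y : C) (f : X ⟶ Y) : partial_hom X Y :=
  span_class (Span f (det_mono_id X)).

Lemma incl_compl (X Y Z D : C) (g : Y ⟶ Z) (i : D ⟶ X) (f : D ⟶ Y)
    (hi : det_mono i) :
  partial_comp (incl g) (span_class (Span f hi)) = span_class (Span (g ∘ f) hi).
Proof.
apply: (@partial_compE _ _ _ _ _ D _ _ _ _ _ _ (idm D) f);
  rewrite ?comp_idr //.
apply: mono_pullback; rewrite ?comp_idl ?comp_idr //; [exact: mono_id..|].
by move=> T a b _; exists a; rewrite comp_idl.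
Qed.

Lemma incl_comp (X Y Z : C) (g : Y ⟶ Z) (f : X ⟶ Y) :
  partial_comp (incl g) (incl f) = incl (g ∘ f).
Proof. exact: incl_compl. Qed.

Lemma partial_comp_idl (X Y : C) (F : partial_hom X Y) :
  partial_comp (incl (idm Y)) F = F.
Proof.
have [[D i f hi] ->] := span_classP F; rewrite incl_compl.
by apply: span_class_ext; rewrite ?comp_idl.
Qed.

Lemma partial_comp_idr (X Y : C) (F : partial_hom X Y) :
  partial_comp F (incl (idm X)) = F.
Proof.
have [[D i f hi] ->] := span_classP F.
apply: (@partial_compE _ _ _ _ _ D _ _ _ _ _ _ i (idm D));
  rewrite ?comp_idl ?comp_idr //.
by apply: (@pullback_iso _ _ _ _ _ _ (idm X) _ _ _ (idm D));
   rewrite ?comp_idl ?comp_idr.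
Qed.

Lemma partial_comp_assoc (W X Y Z : C) (H : partial_hom Y Z)
    (G : partial_hom X Y) (F : partial_hom W X) :
  partial_comp H (partial_comp G F) = partial_comp (partial_comp H G) F.
Proof.
have [[A i f hi] ->] := span_classP F; have [[B j g hj] ->] := span_classP G.
have [[D k h hk] ->] := span_classP H.
have [P [u [v pb1]]] := part_pullback hC f hj.
have hu := part_pullback_det_mono hC hj pb1.
have [E [s [t pb2]]] := part_pullback hC (g ∘ v) hk.
have hs := part_pullback_det_mono hC hk pb2.
have [Q [p [q pb3]]] := part_pullback hC g hk.
have hp := part_pullback_det_mono hC hk pb3.
rewrite (partial_compE hi hj (det_mono_comp hi hu) pb1 erefl erefl).
rewrite (partial_compE _ hk (det_mono_comp (det_mono_comp hi hu) hs)
           pb2 erefl erefl).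
rewrite (partial_compE hj hk (det_mono_comp hj hp) pb3 erefl erefl).
case: pb1 pb2 pb3 => [c1 univ1] [c2 univ2] [c3 univ3].
have e : g ∘ (v ∘ s) = k ∘ t by rewrite comp_assoc.
have [w [[pw qw] _]] := univ3 _ _ _ e.
symmetry; apply: (@partial_compE _ _ _ _ _ E _ _ _ _ _ _ (u ∘ s) w).
- apply: mono_pullback.
  + by case: (det_mono_comp hj hp).
  + by case: (det_mono_comp hu hs).
  + by rewrite comp_assoc c1 -!comp_assoc pw.
  + move=> T a b eab.
  have e1 : f ∘ a = j ∘ (p ∘ b) by rewrite eab comp_assoc.
  have [c [[uc vc] _]] := univ1 _ _ _ e1.
  have e2 : g ∘ v ∘ c = k ∘ (q ∘ b).
    by rewrite -comp_assoc vc !comp_assoc c3.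
  have [r [[sr _] _]] := univ2 _ _ _ e2.
  by exists r; rewrite -comp_assoc sr.
- by rewrite comp_assoc.
- by rewrite -comp_assoc qw.
Qed.

Definition partial_cat : Category :=
  {| Ob := Ob C; Hom := partial_hom; idm := fun X => incl (idm X);
     comp := partial_comp; comp_idl := partial_comp_idl;
     comp_idr := partial_comp_idr; comp_assoc := partial_comp_assoc |}.

Definition span_tens (X X' Y Y' : C) (s : span X X') (t : span Y Y') :
    span (X ⊗ Y) (X' ⊗ Y') :=
  Span (span_map s ⊗₁ span_map t)
    (det_mono_tens (span_leg_det_mono s) (span_leg_det_mono t)).

Definition partial_tens (X X' Y Y' : C)
    (F : partial_hom X X') (G : partial_hom Y Y') :
    partial_hom (X ⊗ Y) (X' ⊗ Y') :=
  span_class (span_tens (span_repr F) (span_repr G)).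

Lemma partial_tens_class (X X' Y Y' : C) (s : span X X') (t : span Y Y') :
  partial_tens (span_class s) (span_class t) = span_class (span_tens s t).
Proof.
symmetry; apply/span_class_eq.
have [a [[a' [ka ka']] [al am]]] := span_repr_equiv s.
have [b [[b' [kb kb']] [bl bm]]] := span_repr_equiv t.
exists (a ⊗₁ b) => /=; rewrite -!tensm_comp al bl am bm; split=> //.
by exists (a' ⊗₁ b'); rewrite -!tensm_comp ka kb ka' kb' !tensm_id.
Qed.

Lemma partial_tensE (X X' Y Y' A B : C) (i : A ⟶ X) (f : A ⟶ X')
    (hi : det_mono i) (j : B ⟶ Y) (g : B ⟶ Y') (hj : det_mono j)
    (hk : det_mono (i ⊗₁ j)) :
  partial_tens (span_class (Span f hi)) (span_class (Span g hj))
  = span_class (Span (f ⊗₁ g) hk).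
Proof. by rewrite partial_tens_class; exact: span_class_ext. Qed.

Lemma incl_tens (X X' Y Y' : C) (f : X ⟶ X') (g : Y ⟶ Y') :
  partial_tens (incl f) (incl g) = incl (f ⊗₁ g).
Proof.
by rewrite partial_tens_class; apply: span_class_ext; rewrite //= tensm_id.
Qed.

Lemma partial_tens_comp (X X' X'' Y Y' Y'' : C)
    (F' : partial_hom X' X'') (F : partial_hom X X')
    (G' : partial_hom Y' Y'') (G : partial_hom Y Y') :
  partial_tens (partial_comp F' F) (partial_comp G' G)
  = partial_comp (partial_tens F' G') (partial_tens F G).
Proof.
have [[A i f hi] ->] := span_classP F; have [[A' i' f' hi'] ->] := span_classP F'.
have [[B j g hj] ->] := span_classP G; have [[B' j' g' hj'] ->] := span_classP G'.
have [P [u [v pb]]] := part_pullback hC f hi'.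
have hu := part_pullback_det_mono hC hi' pb.
have [Q [r [s pb']]] := part_pullback hC g hj'.
have hr := part_pullback_det_mono hC hj' pb'.
rewrite (partial_compE hi hi' (det_mono_comp hi hu) pb erefl erefl).
rewrite (partial_compE hj hj' (det_mono_comp hj hr) pb' erefl erefl).
rewrite !partial_tens_class /span_tens /=; symmetry.
apply: (partial_compE _ _ _ (pullback_tens hi' hj' pb pb'));
  by rewrite tensm_comp.
Qed.

Lemma incl_compr_iso (X X' Z A B : C) (h : X ⟶ X') (h' : X' ⟶ X)
    (k : A ⟶ B) (k' : B ⟶ A) (i : A ⟶ X) (j : B ⟶ X') (g : B ⟶ Z) (f : A ⟶ Z)
    (hi : det_mono i) (hj : det_mono j) :
  h' ∘ h = idm _ -> k' ∘ k = idm _ -> k ∘ k' = idm _ ->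
  h ∘ i = j ∘ k -> f = g ∘ k ->
  partial_comp (span_class (Span g hj)) (incl h) = span_class (Span f hi).
Proof.
move=> eh ek ek' e ef.
apply: (@partial_compE _ _ _ _ _ A _ _ _ _ _ _ i k); rewrite ?comp_idl //.
exact: pullback_iso eh ek' ek e.
Qed.

Definition partial_smc : SymMonCategory.
Proof.
refine {|
  smc_cat := partial_cat;
  tens := (fun X Y : C => X ⊗ Y);
  tensm := partial_tens;
  unit := (unit : C);
  assoc := fun X Y Z : C => incl (assoc X Y Z);
  assoc_inv := fun X Y Z : C => incl (assoc_inv X Y Z);
  lunit := fun X : C => incl (lunit X);
  lunit_inv := fun X : C => incl (lunit_inv X);
  runit := fun X : C => incl (runit X);
  runit_inv := fun X : C => incl (runit_inv X);
  swap := fun X Y : C => incl (swap X Y) |} => /=.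
- abstract (by move=> X Y; rewrite incl_tens tensm_id).
- exact partial_tens_comp.
- abstract (by move=> X Y Z; rewrite incl_comp assocK).
- abstract (by move=> X Y Z; rewrite incl_comp assoc_invK).
- abstract (by move=> X; rewrite incl_comp lunitK).
- abstract (by move=> X; rewrite incl_comp lunit_invK).
- abstract (by move=> X; rewrite incl_comp runitK).
- abstract (by move=> X; rewrite incl_comp runit_invK).
- abstract (by move=> X Y; rewrite incl_comp swapK).
- abstract (
    move=> X X' Y Y' Z Z' F G H;
    have [[A i f hi] ->] := span_classP F;
    have [[B j g hj] ->] := span_classP G;
    have [[D k h hk] ->] := span_classP H;
    rewrite !partial_tens_class /span_tens /= incl_compl; symmetry;
    apply: (incl_compr_iso _ _ (assocK X Y Z) (assocK A B D)
             (assoc_invK A B D)); exact: assoc_nat).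
- abstract (
    move=> X X' F; have [[A i f hi] ->] := span_classP F;
    rewrite !partial_tens_class /span_tens /= !incl_compl; symmetry;
    apply: (incl_compr_iso _ _ (lunitK X) (lunitK A) (lunit_invK A));
    [by rewrite lunit_nat | by rewrite lunit_nat]).
- abstract (
    move=> X X' F; have [[A i f hi] ->] := span_classP F;
    rewrite !partial_tens_class /span_tens /= !incl_compl; symmetry;
    apply: (incl_compr_iso _ _ (runitK X) (runitK A) (runit_invK A));
    [by rewrite runit_nat | by rewrite runit_nat]).
- abstract (
    move=> X X' Y Y' F G;
    have [[A i f hi] ->] := span_classP F;
    have [[B j g hj] ->] := span_classP G;
    rewrite !partial_tens_class /span_tens /= incl_compl; symmetry;
    apply: (incl_compr_iso _ _ (swapK X Y) (swapK A B) (swapK B A));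
    exact: swap_nat).
- abstract (by move=> X Y; rewrite !incl_tens incl_comp triangle).
- abstract (by move=> W X Y Z; rewrite !incl_tens !incl_comp pentagon).
- abstract (by move=> X Y Z; rewrite !incl_tens !incl_comp hexagon).
Defined.

Lemma incl_mid_swap (A B X Y : C) :
  @mid_swap partial_smc A B X Y = incl (mid_swap A B X Y).
Proof. by rewrite /mid_swap /= !(incl_tens, incl_comp). Qed.

Definition Partial : CDCategory.
Proof.
refine {|
  cd_smc := partial_smc;
  copy := fun X : C => incl (copy X);
  del := fun X : C => incl (del X) |} => /=.
- abstract (by move=> X; rewrite !incl_tens !incl_comp copy_assoc).
- abstract (by move=> X; rewrite !incl_tens !incl_comp copy_dell).
- abstract (by move=> X; rewrite !incl_tens !incl_comp copy_delr).
- abstract (by move=> X; rewrite !incl_comp copy_swap).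
- abstract (by move=> X Y; rewrite incl_mid_swap !incl_tens incl_comp copy_tens).
- abstract (by move=> X Y; rewrite !incl_tens !incl_comp del_tens).
- abstract (by rewrite copy_unit).
- abstract (by rewrite del_unit).
Defined.

Lemma partial_quasi_markov : quasi_markov Partial.
Proof.
move=> X Y F; have [[D i f hi] ->] := span_classP F.
rewrite /quasi_total /= incl_compl partial_tens_class /span_tens /= incl_compl.
apply: (@partial_compE _ _ _ _ _ D _ _ _ _ _ _ i (copy D));
  rewrite ?comp_idl //.
- apply: mono_pullback.
  + by case: (det_mono_tens hi hi).
  + by case: hi.
  + by case: hi => [[_ ->]].
  + move=> T a b e; exists (proj1m D D ∘ b).
  rewrite comp_assoc -(proj1m_nat hM _ i) -comp_assoc -e comp_assoc.
  by rewrite proj1m_copy comp_idl.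
- have -> : @del C Y ∘ f = del D by exact: hM.
  rewrite -[f in f ⊗₁ _]comp_idr -[del D]comp_idl tensm_comp !comp_assoc.
  by rewrite runit_nat -!comp_assoc (comp_assoc (runit D)) copy_delr comp_idr.
Qed.

End Partial.

Arguments Span {C X Y span_dom} span_leg span_map span_leg_det_mono.

(* Main.v *)
From Corelib Require Import ssreflect.
Require Import Defs.

(** A span [(D, i, f)] is copyable in the category of partial morphisms exactly
    when its total part [f] is copyable: both [copy ∘ (D, i, f)] and
    [((D, i, f) ⊗₁ (D, i, f)) ∘ copy] have leg [i], and an isomorphism of spans
    with the same monic leg is an identity ([copyable_span]).  Hence applying
    the bijection [f ↦ f♯] to the total part of a span, keeping the leg, should
    exhibit [PX] as a distribution object; the inverse is composition with the
    sampling map.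

    What must be checked is that the morphisms by which this operation has to
    commute with [♯] are copyable, since [♯] is natural only along those.  They
    are the comparison isomorphism between two equivalent spans and the
    projection [v] in the pullback defining a composite of spans.  In each case
    the morphism becomes copyable after composition with a deterministic
    monomorphism [j], and [j ⊗₁ j] is again monic, so the morphism itself is
    copyable ([copyable_cancel]).

    For the pushforward, [P(D, i, f)] is the counterpart of the composite of
    [(D, i, f)] with [samp], computed by pulling [i] back along [samp].  The
    universal property of [♯] only concerns copyable morphisms, so it does not
    directly give that [PD], with projections [Pi] and [samp], is this pullback.
    But a pullback [(E, e, q)] exists and has a deterministic leg [e]; so
    [e = (i ∘ q)♯ = Pi ∘ q♯], and this forces [q♯ : E ⟶ PD] to be invertible
    ([samp_pullback]). *)

Local Open Scope cat_scope.

Section DistributionsOfPartial.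

Set Implicit Arguments.
Unset Strict Implicit.

Variable C : CDCategory.
Hypothesis hC : partializable C.
Variable P : distributions C.

Local Notation "f ♯" := (sharp (dist_iso P _) f)
  (at level 1, format "f ♯").
Local Notation sampl X := (samp (dist_iso P X)).

(** The two sides of the copying equation for [v] become equal after composition
    with [j ⊗₁ j], which is monic. *)
Lemma copyable_cancel (X Y Z : C) (j : Y ⟶ Z) (v : X ⟶ Y) :
  det_mono j -> copyable (j ∘ v) -> copyable v.
Proof.
move=> hj hjv; have [_ mjj] := det_mono_tens hC hj hj; apply: mjj.
rewrite !comp_assoc -tensm_comp -(det_copyable (proj1 hj)) -hjv.
by rewrite comp_assoc.
Qed.

(** A point of [D ⊗ D] lying over the diagonal of [X] is determined by its first
    component. *)
Lemma copy_pullback (D X : C) (i : D ⟶ X) :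
  det_mono i -> is_pullback (copy X) (i ⊗₁ i) i (copy D).
Proof.
move=> hi; apply: mono_pullback.
- by case: (det_mono_tens hC hi hi).
- by case: hi.
- by case: hi => [[_ ->]].
- move=> T a b e; exists (proj1m D D ∘ b).
  rewrite comp_assoc -(proj1m_nat (part_markov hC) _ i) -comp_assoc -e.
  by rewrite comp_assoc proj1m_copy comp_idl.
Qed.

(** The two sides of the copying equation are the spans with leg [i] and total
    parts [copy Y ∘ f] and [(f ⊗₁ f) ∘ copy D]; as [i] is monic, only the
    identity of [D] can relate them. *)
Lemma copyable_span (X Y D : C) (i : D ⟶ X) (f : D ⟶ Y) (hi : det_mono i) :
  @copyable (Partial hC) X Y (span_class (Span i f hi)) <-> copyable f.
Proof.
have pb := copy_pullback hi.
rewrite /copyable /= incl_compl partial_tens_class /span_tens /=.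
rewrite (partial_compE hC _ _ hi pb (eq_sym (comp_idl _)) eq_refl).
rewrite span_class_eq; split=> [[t /= [_ [et ef]]]|e]; last first.
  by rewrite e; exact: span_equiv_refl.
have t1 : t = idm D by apply: (proj2 hi); rewrite et comp_idr.
by move: ef; rewrite t1 comp_idr.
Qed.

Lemma sharp_comp (X A B : C) (f : B ⟶ X) (h : A ⟶ B) :
  copyable h -> cop_val (f ∘ h)♯ = cop_val f♯ ∘ h.
Proof. by move=> hh; rewrite (sharp_nat _ (CopHom hh)). Qed.

Lemma sharp_samp (X A : C) (g : A ⟶ P X) :
  copyable g -> cop_val (sampl X ∘ g)♯ = g.
Proof.
by move=> hg; rewrite -(sharp_unique (g := CopHom hg) (eq_refl (sampl X ∘ g))).
Qed.

Definition span_sharp (X Y : C) (s : span X Y) : span X (P Y) :=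
  Span (span_leg s) (cop_val (span_map s)♯) (span_leg_det_mono s).

Lemma span_sharp_equiv (X Y : C) (s s' : span X Y) :
  span_equiv s s' -> span_equiv (span_sharp s) (span_sharp s').
Proof.
move=> [t [ti [el em]]]; exists t; split=> //=; split=> //.
rewrite -em sharp_comp //; apply: (copyable_cancel (span_leg_det_mono s')).
by rewrite el; exact: det_copyable (proj1 (span_leg_det_mono s)).
Qed.

Lemma copyable_span_sharp (X Y : C) (s : span X Y) :
  @copyable (Partial hC) X (P Y) (span_class (span_sharp s)).
Proof. by apply/copyable_span; exact: cop_prop. Qed.

Definition partial_sharp (X A : C) (F : partial_hom A X) :
    @cop_hom (Partial hC) A (P X) :=
  @CopHom (Partial hC) A (P X) _ (copyable_span_sharp (span_repr F)).

Lemma partial_sharp_class (X A D : C) (i : D ⟶ A) (f : D ⟶ X)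
    (hi : det_mono i) :
  cop_val (partial_sharp (span_class (Span i f hi)))
  = span_class (Span i (cop_val f♯) hi).
Proof.
symmetry; apply/span_class_eq.
exact: (span_sharp_equiv (span_repr_equiv (Span i f hi))).
Qed.

Definition partial_flat (X A : C) (G : @cop_hom (Partial hC) A (P X)) :
    partial_hom A X :=
  partial_comp hC (incl (sampl X)) (cop_val G).

Lemma partial_sharpK (X A : C) (F : partial_hom A X) :
  partial_flat (partial_sharp F) = F.
Proof.
have [[D i f hi] ->] := span_classP F.
by rewrite /partial_flat partial_sharp_class incl_compl samp_sharp.
Qed.

Lemma partial_flatK (X A : C) (G : @cop_hom (Partial hC) A (P X)) :
  partial_sharp (partial_flat G) = G.
Proof.
apply: cop_hom_eq; case: G => G; have [[D i g hi] ->] := span_classP G.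
move=> hG; have hg := proj1 (copyable_span _ _) hG.
rewrite [partial_flat _](incl_compl hC (sampl X) g hi) partial_sharp_class.
by rewrite sharp_samp.
Qed.

(** The composite of [(D, i, f)] after [(E, j, h)] has total part [f ∘ v], with
    [v] the projection to [D] of the pullback of [i] along [h]; [v] is copyable
    since [i ∘ v = h ∘ u] is. *)
Lemma partial_sharp_nat (X A B : C) (H : @cop_hom (Partial hC) A B)
    (F : partial_hom B X) :
  partial_sharp (partial_comp hC F (cop_val H))
  = @comp (Cop (Partial hC)) A B (P X) (partial_sharp F) H.
Proof.
apply: cop_hom_eq; case: H => H /=; have [[E j h hj] ->] := span_classP H.
move=> hH; have hh := proj1 (copyable_span _ _) hH.
have [[D i f hi] ->] := span_classP F.
have [Q [u [v pb]]] := part_pullback hC h hi.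
have hu := part_pullback_det_mono hC hi pb.
have hv : copyable v.
  apply: (copyable_cancel hi); rewrite -(proj1 pb).
  exact: copyable_comp hh (det_copyable (proj1 hu)).
rewrite (partial_compE hC hj hi (det_mono_comp hj hu) pb eq_refl eq_refl).
rewrite [LHS]partial_sharp_class (sharp_comp _ hv).
rewrite -[RHS]/(partial_comp hC (cop_val (partial_sharp
                  (span_class (Span i f hi)))) (span_class (Span j h hj))).
rewrite partial_sharp_class.
by rewrite (partial_compE hC hj hi (det_mono_comp hj hu) pb eq_refl eq_refl).
Qed.

Definition partial_distribution_iso (X : C) :
    @distribution_iso (Partial hC) X (P X) :=
  @Build_distribution_iso (Partial hC) X (P X)
    (@partial_sharp X) (@partial_flat X)
    (@partial_sharpK X) (@partial_flatK X) (@partial_sharp_nat X).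

Lemma samp_partial (X : C) :
  samp (partial_distribution_iso X) = incl (sampl X).
Proof. exact: (@partial_comp_idr C hC _ _ (incl (sampl X))). Qed.

Lemma samp_dist_map (X D : C) (i : D ⟶ X) :
  sampl X ∘ dist_map P i = i ∘ sampl D.
Proof. exact: samp_sharp. Qed.

(** Comparing [PD] with a given pullback [(E, e, q)] of [i] along [samp]: the
    universal property of [E] gives [s : PD ⟶ E] over [Pi] and [samp], and
    [e = Pi ∘ q♯] because [e] is copyable.  Then [q♯ ∘ s = idm] because [s] is
    copyable too, so [Pi = e ∘ s] is monic, and every cone factors through [Pi]
    via [q♯]. *)
Lemma samp_pullback (X D : C) (i : D ⟶ X) : det_mono i ->
  det_mono (cop_val (dist_map P i)) /\
  is_pullback (sampl X) i (cop_val (dist_map P i)) (sampl D).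
Proof.
move=> hi; have [E [e [q pb]]] := part_pullback hC (sampl X) hi.
have he := part_pullback_det_mono hC hi pb; case: pb => [comm univ].
have ee : cop_val (dist_map P i) ∘ q♯ = e.
  rewrite -[RHS](sharp_samp (det_copyable (proj1 he))) comm.
  rewrite -[in RHS](samp_sharp (dist_iso P D) q) comp_assoc.
  by rewrite (sharp_comp _ (cop_prop _)).
have [s [[es qs] _]] := univ _ _ _ (samp_dist_map i).
have hs : copyable s by apply: (copyable_cancel he); rewrite es; exact: cop_prop.
have qsK : cop_val q♯ ∘ s = idm (P D).
  rewrite -(sharp_comp _ hs) qs -[sampl D]comp_idr.
  exact: sharp_samp (copyable_id _).
have hm : mono (cop_val (dist_map P i)).
  rewrite -es; apply: mono_comp (proj2 he) _ => T a b eab.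
  by rewrite -[a]comp_idl -[b]comp_idl -qsK -!comp_assoc eab.
split; first by split=> //; split; [exact: part_markov | exact: cop_prop].
apply: mono_pullback => //; [exact: proj2 hi | exact: samp_dist_map |].
move=> T a b /univ [t [[et _] _]]; exists (cop_val q♯ ∘ t).
by rewrite comp_assoc ee.
Qed.

Lemma partial_dist_map (X Y D : C) (i : D ⟶ X) (f : D ⟶ Y) (hi : det_mono i)
    (hPi : det_mono (cop_val (dist_map P i))) :
  cop_val (partial_sharp (partial_comp hC (span_class (Span i f hi))
                            (incl (sampl X))))
  = span_class (Span (cop_val (dist_map P i)) (cop_val (dist_map P f)) hPi).
Proof.
have [_ pb] := samp_pullback hi.
rewrite (partial_compE hC _ hi hPi pb (eq_sym (comp_idl _)) eq_refl).
exact: partial_sharp_class.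
Qed.

End DistributionsOfPartial.

Theorem proposition1p10 (C : CDCategory) (hC : partializable C)
    (P : distributions C) :
  exists S : forall X : C, @distribution_iso (Partial hC) X (P X),
    (forall X : C, samp (S X) = incl (samp (dist_iso P X)))
    /\ representable (Partial hC)
    /\ (forall (X Y D : C) (i : D ⟶ X) (f : D ⟶ Y) (hi : det_mono i),
          cop_val (sharp (S Y) (span_class (Span i f hi)))
          = span_class (Span i (cop_val (sharp (dist_iso P Y) f)) hi))
    /\ (forall (X Y D : C) (i : D ⟶ X) (f : D ⟶ Y) (hi : det_mono i),
          exists hPi : det_mono (cop_val (fmap (distribution_functor P) i)),
            cop_val
              (fmap (distribution_functor (@Distributions (Partial hC) P S))
                 (span_class (Span i f hi)))
            = span_class
                (Span (cop_val (fmap (distribution_functor P) i))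
                   (cop_val (fmap (distribution_functor P) f)) hPi)).
Proof.
exists (partial_distribution_iso hC P); split; first exact: samp_partial.
split.
  by move=> X; exists (P X); exact: inhabits (partial_distribution_iso hC P X).
split; first by move=> X Y D i f hi; exact: partial_sharp_class.
move=> X Y D i f hi; have [hPi _] := samp_pullback hC P hi; exists hPi.
by rewrite -(partial_dist_map hC f hi) -(samp_partial hC P X).
Qed.
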